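(* Let $\mathcal P^\sharp=\langle\mathcal S^\sharp,\mathcal W_1^\sharp\cup\mathcal W_2^\sharp\cup\mathcal W,\mathcal Q,\mathcal T^\sharp\rangle$ be a DP problem (whose strict component consists of dependency pairs only), let $\mathcal G$ be an approximated dependency graph of $\mathcal P^\sharp$, and suppose $\mathcal W_1^\sharp$ is closed under $\mathcal G$-successors (every successor in $\mathcal G$ of a node in $\mathcal W_1^\sharp$ lies in $\mathcal W_1^\sharp$). Then for every $f:\mathbb N\to\mathbb N$, if the judgement $\langle\mathcal S^\sharp,\mathcal W_2^\sharp\cup\mathcal W,\mathcal Q,\mathcal T^\sharp\rangle\vdash f$ is valid, then the judgement $\mathcal P^\sharp\vdash f$ is valid.
   Context: Fix a signature $\mathcal F$ partitioned into constructors $\mathcal C$ and defined symbols $\mathcal D$, and a countably infinite set of variables $\mathcal V$; $|t|$ is the number of symbol occurrences in $t$. A term is basic if it is $f(s_1,\dots,s_n)$ with $f\in\mathcal D$ and each $s_i$ built from constructors and variables only. For TRSs $\mathcal Q,\mathcal R$, $s\to^{\mathcal Q}_{\mathcal R}t$ iff there are a context $C$, substitution $\sigma$ and rule $f(l_1,\dots,l_n)\to r\in\mathcal R$ with $s=C[f(l_1\sigma,\dots,l_n\sigma)]$, $t=C[r\sigma]$ and all $l_i\sigma$ normal forms of $\mathcal Q$. ${\to^{\mathcal Q}_{\mathcal S/\mathcal W}}=(\to^{\mathcal Q}_{\mathcal W})^*\cdot\to^{\mathcal Q}_{\mathcal S}\cdot(\to^{\mathcal Q}_{\mathcal W})^*$.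 $\mathrm{dh}(t,\to)=\max\{n\mid\exists t_1,\dots,t_n.\ t\to t_1\to\cdots\to t_n\}$ (partial). A complexity problem $\langle\mathcal S,\mathcal W,\mathcal Q,\mathcal T\rangle$ has complexity function $\mathrm{cc}(n)=\max\{\mathrm{dh}(t,\to^{\mathcal Q}_{\mathcal S/\mathcal W})\mid t\in\mathcal T,|t|\le n\}$ (partial); a judgement $\mathcal P\vdash f$ is valid if $\mathrm{cc}_{\mathcal P}$ is defined on all inputs and $\mathrm{cc}_{\mathcal P}\in O(f)$. Marking: for each $n$-ary $f\in\mathcal D$ a fresh $n$-ary $f^\sharp$; $t^\sharp=f^\sharp(t_1,\dots,t_n)$ if $t=f(t_1,\dots,t_n)$ with $f\in\mathcal D$, else $t^\sharp=t$. Compound symbols $c_0,c_1,\dots$ are fresh, $c_n$ of arity $n$; $\mathrm{com}(t)=t$, $\mathrm{com}(t_1,\dots,t_n)=c_n(t_1,\dots,t_n)$ for $n\ne1$. A dependency pair is a rule $l^\sharp\to\mathrm{com}(r_1^\sharp,\dots,r_n^\sharp)$ with $l,r_i$ terms over $\mathcal F\cup\mathcal V$, $l$ not a variable. A DP problem is a complexity problem $\langle\mathcal S^\sharp\cup\mathcal S,\mathcal W^\sharp\cup\mathcal W,\mathcal Q,\mathcal T^\sharp\rangle$ with $\mathcal S,\mathcal W$ TRSs over $\mathcal F$, $\mathcal Q$ a TRS, $\mathcal S^\sharp,\mathcal W^\sharp$ sets of dependency pairs, and $\mathcal T^\sharp$ a set of marked basic terms $t^\sharp$. The dependency graph of such a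 DP problem has as nodes the dependency pairs in $\mathcal S^\sharp\cup\mathcal W^\sharp$, with an arrow labelled $i$ from $s^\sharp\to\mathrm{com}(t_1^\sharp,\dots,t_n^\sharp)$ to $u^\sharp\to\mathrm{com}(v_1^\sharp,\dots,v_m^\sharp)$ whenever there are substitutions $\sigma,\tau$ (into terms over $\mathcal F\cup\mathcal V$) with $t_i^\sharp\sigma\,(\to^{\mathcal Q}_{\mathcal S\cup\mathcal W})^*\,u^\sharp\tau$. An approximated dependency graph is any graph on the same nodes containing all arrows of the dependency graph.
   Formalization: The formal statement additionally assumes that S♯ and W1♯ are disjoint and that left-hand sides l of dependency pairs are rooted by a defined symbol (so l♯ is really marked), and takes var(r) ⊆ var(l) for all rules; without these the claim fails. *)

(* Defs.v *)
From Stdlib Require Import Relation_Operators.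
From mathcomp Require Import all_boot.
From mathcomp Require Import boolp classical_sets.

Set Implicit Arguments.
Unset Strict Implicit.
Unset Printing Implicit Defensive.

Local Open Scope classical_set_scope.

Record signature := Signature { sym : Type; arity : sym -> nat }.

(* The set of variables is nat. *)
Inductive term (F : signature) : Type :=
| Var of nat
| App (f : sym F) of {ffun 'I_(arity f) -> term F}.
Arguments Var {F} _.
Arguments App {F} f _.

Fixpoint tsize (F : signature) (t : term F) : nat :=
  match t with
  | Var _ => 1
  | App f a => (\sum_(i < arity f) tsize (a i)).+1
  end.

Fixpoint occurs (F : signature) (x : nat) (t : term F) : Prop :=
  match t with
  | Var y => x = y
  | App f a => exists i, occurs x (a i)
  end.

Fixpoint subst (F : signature) (sigma : nat -> term F) (t : term F) : term F :=
  match t with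
  | Var x => sigma x
  | App f a => App f [ffun i => subst sigma (a i)]
  end.

(* [CApp f i a C] is f(a_1,..,C,..,a_n) with C at argument i; a_i is ignored. *)
Inductive context (F : signature) : Type :=
| Hole
| CApp (f : sym F) of 'I_(arity f) & {ffun 'I_(arity f) -> term F} & context F.
Arguments Hole {F}.
Arguments CApp {F} f _ _ _.

Fixpoint fill (F : signature) (C : context F) (t : term F) : term F :=
  match C with
  | Hole => t
  | CApp f i a C' => App f [ffun j => if j == i then fill C' t else a j]
  end.

Definition rule (F : signature) : Type := (term F * term F)%type.

Definition is_var (F : signature) (t : term F) : Prop :=
  if t is Var _ then True else False.

Definition is_rule (F : signature) (p : rule F) : Prop :=
  ~ is_var p.1 /\ (forall x, occurs x p.2 -> occurs x p.1).

(* A set of rules, possibly infinite; it is a TRS when [is_trs] holds. *)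
Definition rules (F : signature) : Type := set (rule F).

Definition is_trs (F : signature) (R : rules F) : Prop :=
  forall p, R p -> is_rule p.

Definition rstep (F : signature) (R : rules F) (s t : term F) : Prop :=
  exists (C : context F) (sigma : nat -> term F) (l r : term F),
    [/\ R (l, r), s = fill C (subst sigma l) & t = fill C (subst sigma r)].

Definition normal_form (F : signature) (Q : rules F) (t : term F) : Prop :=
  ~ exists u, rstep Q t u.

Definition qstep (F : signature) (Q R : rules F) (s t : term F) : Prop :=
  exists (C : context F) (sigma : nat -> term F) (f : sym F)
    (l : {ffun 'I_(arity f) -> term F}) (r : term F),
    [/\ R (App f l, r),
        s = fill C (subst sigma (App f l)),
        t = fill C (subst sigma r)
      & forall i, normal_form Q (subst sigma (l i))].

Definition qsteps (F : signature) (Q R : rules F) : term F -> term F -> Prop :=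
  clos_refl_trans (term F) (qstep Q R).

Definition qstep_mod (F : signature) (Q S W : rules F) (s t : term F) : Prop :=
  exists s' t', [/\ qsteps Q W s s', qstep Q S s' t' & qsteps Q W t' t].

Fixpoint chain (T : Type) (R : T -> T -> Prop) (t : T) (ts : seq T) : Prop :=
  if ts is t' :: ts' then R t t' /\ chain R t' ts' else True.

Definition is_max (A : set nat) (m : nat) : Prop :=
  A m /\ forall k, A k -> k <= m.

(* The partial functions dh and cc are given by their graphs. *)
Definition is_dh (T : Type) (R : T -> T -> Prop) (t : T) (m : nat) : Prop :=
  is_max [set n | exists2 ts : seq T, size ts = n & chain R t ts] m.

Record cproblem (F : signature) := CProblem {
  strict : rules F;
  weak : rules F;
  inner : rules F;
  starts : set (term F) }.

Definition cstep (F : signature) (P : cproblem F) : term F -> term F -> Prop :=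
  qstep_mod (inner P) (strict P) (weak P).

(* cc is undefined at n as soon as dh is undefined on some admissible start
   term; adding 0 to the set only fixes max of the empty set to be 0. *)
Definition is_cc (F : signature) (P : cproblem F) (n m : nat) : Prop :=
  (forall t, starts P t -> tsize t <= n -> exists k, is_dh (cstep P) t k) /\
  is_max (0 |` [set k | exists t,
            [/\ starts P t, tsize t <= n & is_dh (cstep P) t k]]) m.

Definition bigO (g f : nat -> nat) : Prop :=
  exists M N, forall n, N <= n -> g n <= M * f n.

Definition valid (F : signature) (P : cproblem F) (f : nat -> nat) : Prop :=
  exists2 c : nat -> nat, (forall n, is_cc P n (c n)) & bigO c f.

Record psignature := PSignature {
  con : Type; con_arity : con -> nat;
  def : Type; def_arity : def -> nat }.

Definition base (F : psignature) : signature :=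
  @Signature (con F + def F)%type (fun f =>
    match f with inl c => con_arity c | inr d => def_arity d end).

Inductive ext_sym (F : psignature) : Type :=
| Base of sym (base F)
| Mark of def F
| Comp of nat.
Arguments Comp {F} _.

Definition ext (F : psignature) : signature :=
  @Signature (ext_sym F) (fun f =>
    match f with
    | Base g => arity g
    | Mark d => def_arity d
    | Comp n => n
    end).

Fixpoint emb (F : psignature) (t : term (base F)) : term (ext F) :=
  match t with
  | Var x => Var x
  | App f a => @App (ext F) (Base f) [ffun i => emb (a i)]
  end.

Definition emb_rules (F : psignature) (R : rules (base F)) : rules (ext F) :=
  (fun p : rule (base F) => (emb p.1, emb p.2)) @` R.

Definition is_con (F : psignature) (f : sym (base F)) : Prop :=
  if f is inl _ then True else False.

Fixpoint con_term (F : psignature) (t : term (base F)) : Prop :=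
  match t with
  | Var _ => True
  | App f a => is_con f /\ forall i, con_term (a i)
  end.

Definition def_rooted (F : psignature) (t : term (base F)) : Prop :=
  if t is App (inr _) _ then True else False.

Definition basic (F : psignature) (t : term (base F)) : Prop :=
  if t is App f a then def_rooted t /\ forall i, con_term (a i) else False.

Definition mark (F : psignature) (t : term (base F)) : term (ext F) :=
  match t with
  | App f a =>
      match f return {ffun 'I_(@arity (base F) f) -> term (base F)} ->
                     term (ext F) with
      | inr d => fun a => @App (ext F) (Mark d) [ffun i => emb (a i)]
      | inl c => fun a => emb (@App (base F) (inl c) a)
      end a
  | Var x => Var x
  end.

Definition com (F : psignature) (ts : seq (term (ext F))) : term (ext F) :=
  match ts with
  | [:: t] => t
  | _ => @App (ext F) (Comp (size ts))
           [ffun i : 'I_(size ts) => tnth (in_tuple ts) i]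
  end.

Definition dp_of (F : psignature) (l : term (base F))
    (rs : seq (term (base F))) : rule (ext F) :=
  (mark l, com [seq mark r | r <- rs]).

(* A left-hand side is rooted by a defined symbol, so that it is really marked:
   constructors are the symbols that do not root left-hand sides. *)
Definition is_dp (F : psignature) (p : rule (ext F)) : Prop :=
  is_rule p /\ exists l rs, def_rooted l /\ p = dp_of l rs.

Record dp_problem (F : psignature) := DPProblem {
  strict_dps : rules (ext F);
  strict_trs : rules (base F);
  weak_dps : rules (ext F);
  weak_trs : rules (base F);
  dp_inner : rules (ext F);
  dp_starts : set (term (ext F)) }.

Definition is_dp_problem (F : psignature) (P : dp_problem F) : Prop :=
  [/\ (forall p, (strict_dps P `|` weak_dps P) p -> is_dp p),
      is_trs (strict_trs P),
      is_trs (weak_trs P),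
      is_trs (dp_inner P)
    & forall t, dp_starts P t -> exists2 s, basic s & t = mark s].

Definition problem_of (F : psignature) (P : dp_problem F) : cproblem (ext F) :=
  CProblem (strict_dps P `|` emb_rules (strict_trs P))
           (weak_dps P `|` emb_rules (weak_trs P))
           (dp_inner P) (dp_starts P).

(* [G p i q]: there is an arrow labelled i from p to q; labels count from 0. *)
Definition graph (F : psignature) : Type :=
  rule (ext F) -> nat -> rule (ext F) -> Prop.

Definition dg_node (F : psignature) (P : dp_problem F) : rules (ext F) :=
  strict_dps P `|` weak_dps P.

Definition dependency_graph (F : psignature) (P : dp_problem F) : graph F :=
  fun p i q =>
    [/\ dg_node P p, dg_node P q &
    exists (l u : term (base F)) (rs vs : seq (term (base F)))
      (sigma tau : nat -> term (base F)),
      [/\ p = dp_of l rs, q = dp_of u vs, i < size rs &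
          qsteps (dp_inner P) (emb_rules (strict_trs P `|` weak_trs P))
            (subst (fun x => emb (sigma x)) (mark (nth (Var 0) rs i)))
            (subst (fun x => emb (tau x)) (mark u))]].

Definition approx_dependency_graph (F : psignature) (P : dp_problem F)
    (G : graph F) : Prop :=
  (forall p i q, G p i q -> dg_node P p /\ dg_node P q) /\
  (forall p i q, dependency_graph P p i q -> G p i q).

Definition successor_closed (F : psignature) (G : graph F)
    (W : rules (ext F)) : Prop :=
  forall p i q, W p -> G p i q -> W q.

(* Main.v *)
Require Import Defs.
From Stdlib Require Import Relation_Operators.
From mathcomp Require Import all_boot.
From mathcomp Require Import boolp classical_sets.

Set Implicit Arguments.
Unset Strict Implicit.
Unset Printing Implicit Defensive.

Local Open Scope classical_set_scope.

(* Every term reachable from a marked basic term is a tree of compound symbols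
   whose leaves are embedded base terms, possibly marked at the root, and a
   dependency pair only ever rewrites a whole leaf. A leaf produced by a pair
   of W1 is dead: since W1 is closed under successors in the dependency graph,
   only pairs of W1 can be applied to it or to its descendants, so it never
   contributes a strict step. Dropping all W1-steps and leaving the leaves they
   were applied to untouched therefore yields a derivation of the smaller
   problem with the same number of strict steps. Hence both problems have the
   same derivation heights on start terms and the same complexity function. *)

(** * Terms and rewrite steps over an arbitrary signature *)

Lemma term_nested_ind (F : signature) (P : term F -> Prop) :
  (forall x, P (Var x)) ->
  (forall f (a : {ffun 'I_(arity f) -> term F}),
     (forall i, P (a i)) -> P (App f a)) ->
  forall t, P t.
Proof.
move=> PVar PApp.
exact: (fix ind t := match t with
  | Var x => PVar x
  | App f a => PApp f a (fun i => ind (a i))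
  end).
Qed.

(** The argument vectors have types depending on the symbol, and symbols need not have decidable
    equality; proof irrelevance turns the equality proof of [f] with itself into [erefl]. *)
Lemma App_inj (F : signature) (f : sym F)
    (a b : {ffun 'I_(arity f) -> term F}) : App f a = App f b -> a = b.
Proof.
move=> [] e.
have := projT2_eq e; by rewrite (Prop_irrelevance (projT1_eq e) erefl).
Qed.

Lemma App_inj_sym (F : signature) (f g : sym F)
    (a : {ffun 'I_(arity f) -> term F}) (b : {ffun 'I_(arity g) -> term F}) :
  App f a = App g b -> f = g.
Proof. by case. Qed.

Lemma eq_in_subst (F : signature) (sigma tau : nat -> term F) (t : term F) :
  (forall x, occurs x t -> sigma x = tau x) -> subst sigma t = subst tau t.
Proof.
elim/term_nested_ind: t => [x|f a IH] /= eq_st; first exact: eq_st.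
congr App; apply/ffunP => i; rewrite !ffunE.
by apply: IH => x x_ai; apply: eq_st; exists i.
Qed.

Definition set_arg (F : signature) (f : sym F)
    (a : {ffun 'I_(arity f) -> term F}) (i : 'I_(arity f)) (u : term F) :
    {ffun 'I_(arity f) -> term F} :=
  [ffun j => if j == i then u else a j].

Definition root_step (F : signature) (Q R : rules F) (s t : term F) : Prop :=
  exists (sigma : nat -> term F) (f : sym F)
    (l : {ffun 'I_(arity f) -> term F}) (r : term F),
    [/\ R (App f l, r), s = subst sigma (App f l), t = subst sigma r
      & forall i, normal_form Q (subst sigma (l i))].

Lemma qstep_Var (F : signature) (Q R : rules F) (x : nat) (t : term F) :
  ~ qstep Q R (Var x) t.
Proof. by case=> [[|g i a C]] [sigma [f [l [r []]]]]. Qed.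

Lemma qstep_App (F : signature) (Q R : rules F) (f : sym F)
    (a : {ffun 'I_(arity f) -> term F}) (t : term F) :
  qstep Q R (App f a) t ->
  root_step Q R (App f a) t \/
  exists i u, qstep Q R (a i) u /\ t = App f (set_arg a i u).
Proof.
case=> [[|g i b C]] [sigma [h [l [r [Rlr def_s def_t nf]]]]].
  by left; exists sigma, h, l, r.
right; have eq_fg := App_inj_sym def_s; case: _ / eq_fg in i b def_s def_t *.
move/App_inj: def_s => def_a.
exists i, (fill C (subst sigma r)); split.
  by exists C, sigma, h, l, r; split=> //; rewrite def_a ffunE eqxx.
rewrite def_t; congr App; apply/ffunP => j; rewrite !ffunE.
by case: eqP => // /eqP/negPf ji; rewrite def_a ffunE ji.
Qed.

Lemma qstep_arg (F : signature) (Q R : rules F) (f : sym F)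
    (a : {ffun 'I_(arity f) -> term F}) (i : 'I_(arity f)) (u : term F) :
  qstep Q R (a i) u -> qstep Q R (App f a) (App f (set_arg a i u)).
Proof.
case=> C [sigma [h [l [r [Rlr def_ai def_u nf]]]]].
exists (CApp f i a C), sigma, h, l, r; split=> //=.
  by congr App; apply/ffunP => j; rewrite ffunE -def_ai; case: eqP => // ->.
by congr App; apply/ffunP => j; rewrite !ffunE -def_u.
Qed.

Lemma sub_qstep (F : signature) (Q R R' : rules F) (s t : term F) :
  R `<=` R' -> qstep Q R s t -> qstep Q R' s t.
Proof.
move=> sRR' [C [sigma [f [l [r [/sRR' Rlr -> -> nf]]]]]].
by exists C, sigma, f, l, r.
Qed.

Lemma qstepU (F : signature) (Q R R' : rules F) (s t : term F) :
  qstep Q (R `|` R') s t -> qstep Q R s t \/ qstep Q R' s t.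
Proof.
by case=> C [sigma [f [l [r [[Rlr|Rlr] -> -> nf]]]]]; [left|right];
  exists C, sigma, f, l, r.
Qed.

(** Isolates the rule that is applied, so that a step can be sorted by whether its dependency pair
    is to be dropped. [Q] stays fixed, hence so do the normal form conditions. *)
Lemma qstep_set1 (F : signature) (Q R : rules F) (s t : term F) :
  qstep Q R s t -> exists2 p, R p & qstep Q [set p] s t.
Proof.
case=> C [sigma [f [l [r [Rlr -> -> nf]]]]].
by exists (App f l, r) => //; exists C, sigma, f, l, r.
Qed.

Lemma sub_qsteps (F : signature) (Q R R' : rules F) (s t : term F) :
  R `<=` R' -> qsteps Q R s t -> qsteps Q R' s t.
Proof.
move=> sRR'; elim=> [x y xy|x|x y z _ xy _]; last exact: rt_trans.
  exact/rt_step/(sub_qstep sRR').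
exact: rt_refl.
Qed.

Lemma sub_qstep_mod (F : signature) (Q S W W' : rules F) (s t : term F) :
  W `<=` W' -> qstep_mod Q S W s t -> qstep_mod Q S W' s t.
Proof.
move=> sWW' [s' [t' [ss' st tt']]].
by exists s', t'; split=> //; apply: sub_qsteps sWW' _.
Qed.

Lemma chain_simulation (T : Type) (R R' sim : T -> T -> Prop) :
  (forall t t' s, sim t t' -> R t s -> exists2 s', R' t' s' & sim s s') ->
  forall t t' ts, sim t t' -> chain R t ts ->
    exists2 ts', size ts' = size ts & chain R' t' ts'.
Proof.
move=> simR t t' ts; elim: ts t t' => [|s ts IH] t t' tt' /=; first by exists [::].
case=> /(simR _ _ _ tt')[s' t's' ss'] /(IH _ _ ss')[ts' sz ch].
by exists (s' :: ts'); rewrite /= ?sz.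
Qed.

(** Derivation height, including whether it is defined, depends only on the set of chain lengths,
    and complexity only on the heights of start terms. *)
Lemma eq_valid (F : signature) (S S' W W' Q : rules F) (T : set (term F))
    (f : nat -> nat) :
  (forall t n, T t ->
     (exists2 ts, size ts = n & chain (qstep_mod Q S W) t ts) <->
     (exists2 ts, size ts = n & chain (qstep_mod Q S' W') t ts)) ->
  valid (CProblem S W Q T) f -> valid (CProblem S' W' Q T) f.
Proof.
move=> eq_chain [c cc_c Of].
have eq_dh t k : T t ->
    is_dh (qstep_mod Q S W) t k = is_dh (qstep_mod Q S' W') t k.
  move=> Tt; rewrite /is_dh; congr is_max.
  by apply/seteqP; split=> n /=; case: (eq_chain t n Tt).
exists c => // n; case: (cc_c n) => dh_def cmax; split.
  move=> t /= Tt /(dh_def t Tt)[k]; rewrite /cstep /= eq_dh //; by exists k.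
congr (is_max (_ `|` _) _): cmax; apply/seteqP; split=> k /= [t [Tt szt]].
  by rewrite /cstep /= eq_dh // => dhk; exists t.
by rewrite /cstep /= -eq_dh // => dhk; exists t.
Qed.

(** * Terms of the base signature inside the extended signature *)

Definition is_emb (F : psignature) (t : term (ext F)) : Prop :=
  exists u, t = emb u.

(* The maximal subterms without compound symbols of terms reachable from
   marked basic terms. An embedded leaf may be rooted by a defined symbol: a
   collapsing component of a dependency pair puts it there. *)
Definition leaf (F : psignature) (t : term (ext F)) : Prop :=
  is_emb t \/
  exists (d : def F) (a : {ffun 'I_(@arity (ext F) (Mark d)) -> term (ext F)}),
    t = @App (ext F) (Mark d) a /\ forall i, is_emb (a i).

Lemma occurs_emb (F : psignature) (x : nat) (t : term (base F)) :
  occurs x (emb t) <-> occurs x t.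
Proof.
elim/term_nested_ind: t => //= f a IH.
by split=> -[i]; [rewrite ffunE IH|rewrite -IH] => xi; exists i; rewrite ?ffunE.
Qed.

Lemma subst_emb (F : psignature) (tau : nat -> term (base F))
    (t : term (base F)) :
  subst (fun x => emb (tau x)) (emb t) = emb (subst tau t).
Proof.
elim/term_nested_ind: t => //= f a IH.
by congr App; apply/ffunP => i; rewrite !ffunE IH.
Qed.

Lemma is_emb_App (F : psignature) (f : sym (base F))
    (a : {ffun 'I_(@arity (ext F) (Base f)) -> term (ext F)}) :
  is_emb (@App (ext F) (Base f) a) <-> forall i, is_emb (a i).
Proof.
split=> [[[//|g b] /= e] i|emb_a].
  have [eq_fg] := App_inj_sym e; case: _ / eq_fg in b e.
  by move/App_inj: e => ->; rewrite ffunE; exists (b i).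
have [b def_a] := choice emb_a.
by exists (App f [ffun i => b i]) => /=; congr App; apply/ffunP => i; rewrite !ffunE.
Qed.

Lemma is_emb_subst_emb (F : psignature) (sigma : nat -> term (ext F))
    (t : term (base F)) (x : nat) :
  is_emb (subst sigma (emb t)) -> occurs x t -> is_emb (sigma x).
Proof.
elim/term_nested_ind: t => [y /= emb_y ->//|f a IH].
move=> /is_emb_App emb_a /= [i]; apply: IH.
by have := emb_a i; rewrite !ffunE.
Qed.

(** Bridges a mismatch: rewriting substitutes terms of the extended signature, whereas arrows of the
    dependency graph ask for substitutions into base terms. *)
Lemma unembed_subst (F : psignature) (sigma : nat -> term (ext F)) :
  exists tau : nat -> term (base F),
    forall x, is_emb (sigma x) -> sigma x = emb (tau x).
Proof.
have tauP x : exists v, is_emb (sigma x) -> sigma x = emb v.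
  by have [[v ->]|nemb] := pselect (is_emb (sigma x)); [exists v|exists (Var 0)].
by have [tau] := choice tauP; exists tau.
Qed.

Lemma leaf_subst_mark (F : psignature) (tau : nat -> term (base F))
    (t : term (base F)) : leaf (subst (fun x => emb (tau x)) (mark t)).
Proof.
case: t => [x|[c|d] a]; first by left; exists (tau x).
  left; exists (subst tau (App (inl c : sym (base F)) a)).
  exact: (subst_emb tau (App (inl c : sym (base F)) a)).
right; exists d, [ffun i => emb (subst tau (a i))]; split.
  by rewrite /=; congr App; apply/ffunP => i; rewrite !ffunE subst_emb.
by move=> i; rewrite ffunE; eexists.
Qed.

(** Absorbs the irregularity of [com], which adds no compound symbol to a single component. *)
Lemma subst_com_ind (F : psignature) (P : term (ext F) -> Prop)
    (sigma : nat -> term (ext F)) (rs : seq (term (base F))) :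
  (forall n (a : {ffun 'I_(@arity (ext F) (Comp n)) -> term (ext F)}),
     (forall i, P (a i)) -> P (@App (ext F) (Comp n) a)) ->
  (forall i, i < size rs -> P (subst sigma (mark (nth (Var 0) rs i)))) ->
  P (subst sigma (com [seq mark r | r <- rs])).
Proof.
move=> PComp; case: rs => [|r [|r' rs]] Prs.
- by apply: PComp => -[].
- exact: (Prs 0).
- apply: PComp => i; rewrite ffunE -/subst ffunE (tnth_nth (mark (Var 0))).
  have lti : i < size [:: r, r' & rs].
    by rewrite -(size_map (@mark F)); exact: ltn_ord.
  by have := Prs i lti; rewrite -(nth_map _ (mark (Var 0))).
Qed.

(** * Steps on leaves *)

(** In a root step, the variables of the right-hand side occur on the left, where matching an
    embedded term forces embedded values. *)
Lemma is_emb_step (F : psignature) (Q : rules (ext F)) (W : rules (base F))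
    (t s : term (ext F)) :
  is_trs W -> is_emb t -> qstep Q (emb_rules W) t s -> is_emb s.
Proof.
move=> trsW [u ->]; elim/term_nested_ind: u s => [x s /qstep_Var//|f a IH s].
case/qstep_App=> [[sigma [g [l [r [[[l' r'] Wlr [/= def_l def_r]] def_s -> _]]]]]|].
  have [_ /= occ_lr] := trsW _ Wlr; rewrite -def_r.
  have [tau tauP] := unembed_subst sigma.
  rewrite (@eq_in_subst _ _ (fun x => emb (tau x))); last first.
    move=> x /occurs_emb/occ_lr x_l; apply/tauP/(is_emb_subst_emb _ x_l).
    by exists (App f a); rewrite def_l; apply: esym.
  by rewrite subst_emb; eexists.
case=> i [u [step ->]]; apply/is_emb_App => j; rewrite !ffunE.
by case: eqP => _; [apply: (IH i); rewrite ffunE in step|eexists].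
Qed.

Lemma emb_rule_root (F : psignature) (W : rules (base F)) (f : sym (ext F))
    (l : {ffun 'I_(arity f) -> term (ext F)}) (r : term (ext F)) :
  is_trs W -> emb_rules W (App f l, r) -> exists g, f = Base g.
Proof.
move=> trsW [[[x|g b] r'] /trsW[//= _ _] /(congr1 fst)/App_inj_sym <-].
by exists g.
Qed.

Lemma leaf_step (F : psignature) (Q : rules (ext F)) (W : rules (base F))
    (t s : term (ext F)) :
  is_trs W -> leaf t -> qstep Q (emb_rules W) t s -> leaf s.
Proof.
move=> trsW [emb_t|[d [a [-> emb_a]]]] st.
  by left; apply: is_emb_step st.
right; case/qstep_App: st => [[sigma [g [l [r]]]]|].
  by case=> /(emb_rule_root trsW)[h eg] /App_inj_sym ef; have := etrans ef eg.
case=> i [u [step ->]]; exists d, (set_arg a i u); split=> // j.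
by rewrite ffunE; case: eqP => // _; apply: is_emb_step step.
Qed.

Lemma is_dpP (F : psignature) (p : rule (ext F)) :
  is_dp p -> exists l rs d (a : {ffun 'I_(@arity (base F) (inr d)) -> _}),
  [/\ l = App (inr d : sym (base F)) a, p = dp_of l rs & is_rule p].
Proof.
case=> rule_p [[x|[c|d] a] [rs [//= _ def_p]]].
by exists (App (inr d : sym (base F)) a), rs, d, a.
Qed.

Lemma dp_root (F : psignature) (p : rule (ext F)) (f : sym (ext F))
    (l : {ffun 'I_(arity f) -> term (ext F)}) (r : term (ext F)) :
  is_dp p -> [set p] (App f l, r) -> exists d, f = Mark d.
Proof.
move=> /is_dpP[l' [rs [d [b [-> -> _]]]]] /(congr1 fst)/App_inj_sym ->.
by exists d.
Qed.

(** Left-hand sides of dependency pairs have a marked root, and embedded terms contain no marked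
    symbol. *)
Lemma is_emb_dp_step (F : psignature) (Q : rules (ext F)) (p : rule (ext F))
    (t s : term (ext F)) :
  is_dp p -> is_emb t -> ~ qstep Q [set p] t s.
Proof.
move=> dp_p [u ->]; elim/term_nested_ind: u s => [x s /qstep_Var//|f a IH s].
case/qstep_App=> [[sigma [g [l [r]]]]|[i [u []]]].
  by case=> /(dp_root dp_p)[d eg] /App_inj_sym ef; have := etrans ef eg.
by rewrite ffunE => /IH.
Qed.

Lemma is_emb_subst_mark (F : psignature) (sigma : nat -> term (ext F))
    (t : term (base F)) (d : def F)
    (a : {ffun 'I_(@arity (ext F) (Mark d)) -> term (ext F)}) (x : nat) :
  def_rooted t -> (forall i, is_emb (a i)) ->
  @App (ext F) (Mark d) a = subst sigma (mark t) -> occurs x (mark t) ->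
  is_emb (sigma x).
Proof.
case: t => [//|[//|d'] b] _ emb_a def_t [i]; rewrite ffunE => /occurs_emb x_bi.
apply: is_emb_subst_emb x_bi.
have [ed] := App_inj_sym def_t; case: _ / ed in b i def_t *.
by move/App_inj: def_t => def_a; have := emb_a i; rewrite def_a !ffunE.
Qed.

(** The arguments of a marked leaf are embedded, so the pair applies at its root and the matched
    variables get embedded values. By the variable condition these determine the reduct too. *)
Lemma leaf_dp_step (F : psignature) (Q : rules (ext F)) (p : rule (ext F))
    (t s : term (ext F)) :
  is_dp p -> leaf t -> qstep Q [set p] t s ->
  exists l rs (tau : nat -> term (base F)),
    [/\ p = dp_of l rs, t = subst (fun x => emb (tau x)) (mark l)
      & s = subst (fun x => emb (tau x)) (com [seq mark r | r <- rs])].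
Proof.
move=> dp_p [/(is_emb_dp_step dp_p)/[apply]//|[d [a [-> emb_a]]]].
case/qstep_App=> [|[i [u [/(is_emb_dp_step dp_p (emb_a i))//]]]].
case=> sigma [g [l' [r [/= e def_t -> _]]]].
have [l [rs [d' [b [def_l def_p [_ occ_p]]]]]] := is_dpP dp_p.
have [tau tauP] := unembed_subst sigma.
have [em er] : (App g l', r) = dp_of l rs by rewrite e.
have {}def_t : @App (ext F) (Mark d) a = subst sigma (mark l) by rewrite -em.
have tau_l x : occurs x (mark l) -> sigma x = emb (tau x).
  move=> x_l; apply/tauP/(is_emb_subst_mark _ emb_a def_t x_l).
  by rewrite def_l.
exists l, rs, tau; split=> //; first by rewrite def_t; apply: eq_in_subst.
rewrite er; apply: eq_in_subst => x x_r; apply: tau_l.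
by have := occ_p x; rewrite def_p; apply.
Qed.

Lemma qstep_Comp (F : psignature) (Q R : rules (ext F)) (n : nat)
    (a : {ffun 'I_(@arity (ext F) (Comp n)) -> term (ext F)})
    (s : term (ext F)) :
  (forall f l r, R (App f l, r) -> f <> Comp n) ->
  qstep Q R (@App (ext F) (Comp n) a) s ->
  exists i u, qstep Q R (a i) u /\ s = @App (ext F) (Comp n) (set_arg a i u).
Proof.
move=> RComp /qstep_App[[sigma [g [l [r [/RComp ng /App_inj_sym eg _ _]]]]]|//].
by case: ng.
Qed.

Lemma qstep_emb_Comp (F : psignature) (Q : rules (ext F)) (W : rules (base F))
    (n : nat) (a : {ffun 'I_(@arity (ext F) (Comp n)) -> term (ext F)})
    (s : term (ext F)) :
  is_trs W -> qstep Q (emb_rules W) (@App (ext F) (Comp n) a) s ->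
  exists i u, qstep Q (emb_rules W) (a i) u /\
    s = @App (ext F) (Comp n) (set_arg a i u).
Proof.
by move=> trsW; apply: qstep_Comp => f l r /(emb_rule_root trsW)[g ->].
Qed.

Lemma qstep_dp_Comp (F : psignature) (Q : rules (ext F)) (p : rule (ext F))
    (n : nat) (a : {ffun 'I_(@arity (ext F) (Comp n)) -> term (ext F)})
    (s : term (ext F)) :
  is_dp p -> qstep Q [set p] (@App (ext F) (Comp n) a) s ->
  exists i u, qstep Q [set p] (a i) u /\
    s = @App (ext F) (Comp n) (set_arg a i u).
Proof.
by move=> dp_p; apply: qstep_Comp => f l r /(dp_root dp_p)[d ->].
Qed.

(** * Dead subterms and the simulation *)

Section Simulation.

Variables (F : psignature) (P : dp_problem F) (D : rules (ext F)).

Local Notation N := (dg_node P).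
Local Notation W := (strict_trs P `|` weak_trs P).
Local Notation Q := (dp_inner P).

Hypothesis dpP : is_dp_problem P.
Hypothesis D_node : D `<=` N.
Hypothesis D_closed : successor_closed (dependency_graph P) D.

(* Every dependency pair that can become applicable in a dead term is in [D]. *)
Inductive dead : term (ext F) -> Prop :=
| dead_leaf t : leaf t ->
    (forall u vs (tau : nat -> term (base F)), N (dp_of u vs) ->
       qsteps Q (emb_rules W) t (subst (fun x => emb (tau x)) (mark u)) ->
       D (dp_of u vs)) ->
    dead t
| dead_Comp n (a : {ffun 'I_(@arity (ext F) (Comp n)) -> term (ext F)}) :
    (forall i, dead (a i)) -> dead (@App (ext F) (Comp n) a).

(* [sim t t']: [t'] is the partner of [t] in the derivation that skips all
   [D]-steps; at the dead positions of [t] its content is irrelevant. *)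
Inductive sim : term (ext F) -> term (ext F) -> Prop :=
| sim_leaf t : leaf t -> sim t t
| sim_dead t t' : dead t -> sim t t'
| sim_Comp n (a b : {ffun 'I_(@arity (ext F) (Comp n)) -> term (ext F)}) :
    (forall i, sim (a i) (b i)) ->
    sim (@App (ext F) (Comp n) a) (@App (ext F) (Comp n) b).

Let trsW : is_trs W.
Proof. by case: dpP => _ trsS trsW _ _ p [/trsS|/trsW]. Qed.

Let dpN p : N p -> is_dp p.
Proof. by case: dpP => dpN _ _ _ _ /dpN. Qed.

(** If the [i]-th component of the reduct rewrites to an instance of the left-hand side of a pair,
    this is an arrow labelled [i] leaving [p], and closure puts that pair into [D]. *)
Lemma leaf_dead_step p t s : D p -> leaf t -> qstep Q [set p] t s -> dead s.
Proof.
move=> Dp leaf_t /(leaf_dp_step (dpN (D_node Dp)) leaf_t).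
case=> l [rs [tau [def_p _ ->]]]; apply: subst_com_ind; first exact: dead_Comp.
move=> i lti; apply: dead_leaf => [|u vs tau' Nq steps].
  exact: leaf_subst_mark.
apply: (D_closed (p := p) (i := i)) => //; split=> //; first exact: D_node.
by exists l, u, rs, vs, tau, tau'.
Qed.

Lemma dead_emb_step t s : dead t -> qstep Q (emb_rules W) t s -> dead s.
Proof.
move=> dead_t; elim: dead_t s => {t} [t leaf_t Dt s ts|n a dead_a IH s].
  apply: dead_leaf => [|u vs tau Nq st]; first exact: leaf_step ts.
  (* Whatever the reduct reaches, the original leaf reaches through it. *)
  by apply: Dt Nq _; apply: rt_trans (rt_step _ _ _ _ ts) st.
case/(qstep_emb_Comp trsW)=> i [u [/IH dead_u ->]].
by apply: dead_Comp => j; rewrite ffunE; case: eqP.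
Qed.

Lemma dead_dp_step p t s :
  N p -> dead t -> qstep Q [set p] t s -> D p /\ dead s.
Proof.
move=> Np dead_t; elim: dead_t s => {t} [t leaf_t Dt s ts|n a dead_a IH s].
  have Dp : D p.
    have [l [rs [tau [def_p def_t _]]]] := leaf_dp_step (dpN Np) leaf_t ts.
    (* The leaf already is an instance of the left-hand side, so deadness is used with zero rewrite
       steps. *)
    by rewrite def_p in Np *; apply: (Dt _ _ tau) => //; rewrite def_t; apply: rt_refl.
  by split=> //; apply: leaf_dead_step ts.
case/(qstep_dp_Comp (dpN Np))=> i [u [/IH[Dp dead_u] ->]]; split=> //.
by apply: dead_Comp => j; rewrite ffunE; case: eqP.
Qed.

Lemma sim_skip_step p t t' s : D p -> sim t t' -> qstep Q [set p] t s -> sim s t'.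
Proof.
move=> Dp tt'; elim: tt' s => {t t'} [t leaf_t s ts|t t' dead_t s ts|n a b ab IH s].
- exact/sim_dead/(leaf_dead_step Dp leaf_t ts).
- by have [_] := dead_dp_step (D_node Dp) dead_t ts; apply: sim_dead.
- case/(qstep_dp_Comp (dpN (D_node Dp)))=> i [u [/IH ub ->]].
  by apply: sim_Comp => j; rewrite ffunE; case: eqP => // ->.
Qed.

(** The redex cannot be at a dead position, so it lies in a leaf that coincides with its partner;
    the very same step, with the same normal form conditions, is available there. *)
Lemma sim_dp_step p t t' s :
  N p -> ~ D p -> sim t t' -> qstep Q [set p] t s ->
  exists2 s', qstep Q [set p] t' s' & sim s s'.
Proof.
move=> Np nDp tt'; elim: tt' s => {t t'} [t leaf_t s ts|t t' dead_t s ts|n a b ab IH s].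
- exists s => //; have [l [rs [tau [_ _ ->]]]] := leaf_dp_step (dpN Np) leaf_t ts.
  (* The reduct need not be a leaf, but it is built from leaves by compound symbols and so is
     related to itself. *)
  apply: (subst_com_ind (P := fun t => sim t t)) => [m c|i _].
    exact: sim_Comp.
  exact/sim_leaf/leaf_subst_mark.
- by have [] := dead_dp_step Np dead_t ts.
- case/(qstep_dp_Comp (dpN Np))=> i [u [/IH[u' bu' uu'] ->]].
  exists (@App (ext F) (Comp n) (set_arg b i u')); first exact: qstep_arg.
  by apply: sim_Comp => j; rewrite !ffunE; case: eqP.
Qed.

(** A step inside a dead leaf may have no counterpart in the partner, which then stays put. This
    loses nothing in the count as long as base rules are only weak. *)
Lemma sim_emb_step t t' s :
  sim t t' -> qstep Q (emb_rules W) t s ->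
  sim s t' \/ exists2 s', qstep Q (emb_rules W) t' s' & sim s s'.
Proof.
move=> tt'; elim: tt' s => {t t'} [t leaf_t s ts|t t' dead_t s ts|n a b ab IH s].
- by right; exists s => //; apply/sim_leaf/(leaf_step trsW leaf_t ts).
- by left; apply/sim_dead/(dead_emb_step dead_t ts).
- case/(qstep_emb_Comp trsW)=> i [u [/IH[ub|[u' bu' uu']] ->]]; [left|right].
    by apply: sim_Comp => j; rewrite ffunE; case: eqP => // ->.
  exists (@App (ext F) (Comp n) (set_arg b i u')); first exact: qstep_arg.
  by apply: sim_Comp => j; rewrite !ffunE; case: eqP.
Qed.

Lemma sim_weak_steps (R : rules (ext F)) t t' s :
  R `<=` N -> sim t t' -> qsteps Q (D `|` R `|` emb_rules W) t s ->
  exists2 s', qsteps Q (R `|` emb_rules W) t' s' & sim s s'.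
Proof.
move=> RN tt' ts; elim: ts t' tt' => {t s} [t s ts|t|t u s _ IHt _ IHu] t' tt'.
- case/qstepU: ts => [/qstep_set1[p DRp ts]|/(sim_emb_step tt')].
    (* A pair lying in both [D] and [R] is skipped too; only pairs outside [D] are replayed. *)
    have [Dp|nDp] := pselect (D p).
      by exists t'; [apply: rt_refl|apply: sim_skip_step ts].
    have Rp : R p by case: DRp.
    have [s' ts' ss'] := sim_dp_step (RN _ Rp) nDp tt' ts.
    exists s' => //; apply/rt_step/(sub_qstep _ ts') => _ ->; by left.
  case=> [st'|[s' ts' ss']]; first by exists t' => //; apply: rt_refl.
  exists s' => //; apply/rt_step/(sub_qstep _ ts') => q; by right.
- by exists t' => //; apply: rt_refl.
- have [u' tu' uu'] := IHt _ tt'; have [s' us' ss'] := IHu _ uu'.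
  by exists s' => //; apply: rt_trans tu' us'.
Qed.

(** Disjointness of [S] and [D] ensures that the strict step is replayed rather than skipped, so the
    number of strict steps is preserved. *)
Lemma sim_qstep_mod (S R : rules (ext F)) t t' s :
  S `<=` N -> R `<=` N -> S `&` D = set0 -> sim t t' ->
  qstep_mod Q S (D `|` R `|` emb_rules W) t s ->
  exists2 s', qstep_mod Q S (R `|` emb_rules W) t' s' & sim s s'.
Proof.
move=> SN RN SD0 tt' [u [v [tu /qstep_set1[p Sp uv] vs]]].
have nDp : ~ D p by move=> Dp; have : (S `&` D) p by []; rewrite SD0.
have [u' tu' uu'] := sim_weak_steps RN tt' tu.
have [v' uv' vv'] := sim_dp_step (SN _ Sp) nDp uu' uv.
have [s' vs' ss'] := sim_weak_steps RN vv' vs.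
by exists s' => //; exists u', v'; split=> //; apply: sub_qstep uv' => _ ->.
Qed.

Lemma sim_start t : dp_starts P t -> sim t t.
Proof.
case: dpP => _ _ _ _ startsP /startsP[s basic_s ->]; apply: sim_leaf.
case: s basic_s => [x|[c|d] a] /= [] // _ _; right; exists d.
by exists [ffun i => emb (a i)]; split=> // i; rewrite ffunE; eexists.
Qed.

End Simulation.

Theorem mainTheorem12 (F : psignature)
    (Sdp W1dp W2dp : rules (ext F)) (W : rules (base F)) (Q : rules (ext F))
    (T : set (term (ext F))) (G : graph F) :
  is_dp_problem (DPProblem Sdp set0 (W1dp `|` W2dp) W Q T) ->
  Sdp `&` W1dp = set0 ->
  approx_dependency_graph (DPProblem Sdp set0 (W1dp `|` W2dp) W Q T) G ->
  successor_closed G W1dp ->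
  forall f : nat -> nat,
    valid (problem_of (DPProblem Sdp set0 W2dp W Q T)) f ->
    valid (problem_of (DPProblem Sdp set0 (W1dp `|` W2dp) W Q T)) f.
Proof.
set P := DPProblem Sdp set0 (W1dp `|` W2dp) W Q T.
move=> dpP SW1 [_ DG_G] W1_G f.
(* Closure passes from [G] to the dependency graph, which has fewer arrows or the same ones. *)
have W1_closed : successor_closed (dependency_graph P) W1dp.
  by move=> p i q W1p /DG_G; apply: W1_G.
have W1N : W1dp `<=` dg_node P by move=> p W1p; right; left.
have W2N : W2dp `<=` dg_node P by move=> p W2p; right; right.
have SN : Sdp `<=` dg_node P by move=> p Sp; left.
rewrite /problem_of /= /emb_rules image_set0 setU0; apply: eq_valid => t n Tt.
split=> -[ts <- ts_chain].
  (* Adding weak rules keeps every derivation, so equality is a simulation in this direction. *)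
  apply: chain_simulation (erefl t) ts_chain => u _ s <- us; exists s => //.
  by apply: sub_qstep_mod us => p [W2p|Wp]; [left; right|right].
apply: chain_simulation (sim_start (P := P) W1dp dpP Tt) ts_chain => u u' s uu'.
have := sim_qstep_mod dpP W1N W1_closed SN W2N SW1 uu' (s := s).
by rewrite /= set0U.
Qed.
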